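(* Let $(P^n_t)_{n\in\mathbb{N},t\ge0}$ be a sequence of strongly continuous semigroups on a Banach space $Z$ with generators $(A^n)_{n\in\mathbb{N}}$ such that there are uniform (in $n$) growth bounds $M\ge1$ and $\omega\in\mathbb{R}$ with $\|P^n_t\|_{L(Z)}\le M\exp(\omega t)$ for $t\ge0$. Let furthermore $D\subset\bigcap_n\operatorname{dom}(A^n)$ be a subset with the following two properties: (i) The linear span $\operatorname{span}(D)$ is dense. (ii) There is a norm $\|\cdot\|_D$ on $\operatorname{span}(D)$ such that for each $f\in D$ and each $t>0$ there exists a sequence $a^{f,t}_{nm}$, possibly depending on $f$ and $t$, with $a^{f,t}_{nm}\to0$ as $n,m\to\infty$, such that $$\|A^nP^m_uf-A^mP^m_uf\|\le a^{f,t}_{nm}\|f\|_D$$ holds for all $n,m$ and for $0\le u\le t$ (in particular $P^m_uf\in\operatorname{dom}(A^n)$ for these $n,m,u$). Then there exists a strongly continuous semigroup $(P^\infty_t)_{t\ge0}$ on $Z$ with the same growth bound such that $\lim_{n\to\infty}P^n_tf=P^\infty_tf$ for all $f\in Z$, uniformly on compacts in time. If in addition $Z=\mathcal{B}^\rho(X)$ for a weighted space $(X,\rho)$ and for each $n\in\mathbb{N}$ $(P^n_t)_{t\ge0}$ is a generalized Feller semigroup, then this property transfers also to the limiting semigroup.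
   Context: A weighted space is a completely regular Hausdorff space $X$ with an admissible weight function $\rho:X\to(0,\infty)$, i.e. $K_R=\{\rho\le R\}$ is compact for all $R>0$. $\mathrm{B}^\rho(X)$ is the Banach space of functions $f:X\to\mathbb{R}$ with $\|f\|_\rho=\sup_x\rho(x)^{-1}|f(x)|<\infty$, and $\mathcal{B}^\rho(X)$ is the closure of $C_b(X)$ in $\mathrm{B}^\rho(X)$. A generalized Feller semigroup on $\mathcal{B}^\rho(X)$ is a family of bounded linear operators $(P_t)_{t\ge0}$ on $\mathcal{B}^\rho(X)$ with $P_0=I$, $P_{t+s}=P_tP_s$, $\lim_{t\to0}P_tf(x)=f(x)$ for all $f\in\mathcal{B}^\rho(X)$, $x\in X$, $\|P_t\|_{L(\mathcal{B}^\rho(X))}\le C$ for $t\in[0,\varepsilon]$ for some $C$ and $\varepsilon>0$, and $P_tf\ge0$ for $f\ge0$. *)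

(* Defs.v *)
From HB Require Import structures.
From mathcomp Require Import all_boot all_order all_algebra.
From mathcomp Require Import all_classical all_reals all_analysis.
Set Implicit Arguments.
Unset Strict Implicit.
Unset Printing Implicit Defensive.
Import Order.TTheory GRing.Theory Num.Theory.
Import numFieldNormedType.Exports.
Local Open Scope classical_set_scope.
Local Open Scope ring_scope.

Section operators.
Context {R : realType} {Z : normedModType R}.
Implicit Types (T : Z -> Z) (P : R -> Z -> Z) (D V : set Z) (N : Z -> R).

(* Valued in the extended reals, so that it is [+oo] on an unbounded
   operator. *)
Definition opnorm T : \bar R :=
  ereal_sup [set (`|T z|)%:E | z in [set z | `|z| <= 1]].

Definition bounded_operator T : Prop := linear T /\ (opnorm T < +oo)%E.

(* Families of operators indexed by [t >= 0] are total functions of [t : R];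
   their values at negative times are unconstrained. *)
Definition operator_semigroup P : Prop :=
  [/\ forall t : R, 0 <= t -> bounded_operator (P t),
      forall z, P 0 z = z &
      forall (s t : R) z, 0 <= s -> 0 <= t -> P (t + s) z = P t (P s z)].

Definition C0_semigroup P : Prop :=
  operator_semigroup P /\ forall z, P t z @[t --> 0^'+] --> z.

Definition growth_bound (M omega : R) P : Prop :=
  forall t : R, 0 <= t -> (opnorm (P t) <= (M * expR (omega * t))%:E)%E.

Definition generator_dom P : set Z :=
  [set z | cvg ((t^-1 *: (P t z - z)) @[t --> 0^'+])].

(* Meaningful only on [generator_dom P]. *)
Definition generator P (z : Z) : Z :=
  lim ((t^-1 *: (P t z - z)) @[t --> 0^'+]).

Definition lspan D : set Z :=
  [set z | exists (k : nat) (c : 'I_k -> R) (d : 'I_k -> Z),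
     (forall i, D (d i)) /\ z = \sum_(i < k) c i *: d i].

(* [N] is a norm on the linear subspace [V]; its values outside [V] are
   unconstrained. *)
Definition is_norm_on V N : Prop :=
  [/\ forall z, V z -> 0 <= N z,
      forall z, V z -> N z = 0 -> z = 0,
      forall (c : R) z, V z -> N (c *: z) = `|c| * N z &
      forall y z, V y -> V z -> N (y + z) <= N y + N z].

Definition generators_Cauchy_on D (P : nat -> R -> Z -> Z) : Prop :=
  exists2 N : Z -> R, is_norm_on (lspan D) N &
    forall f (t : R), D f -> 0 < t ->
      exists2 a : nat -> nat -> R,
        a nm.1 nm.2 @[nm --> (\oo, \oo)] --> (0 : R) &
        forall (n m : nat) (u : R), 0 <= u <= t ->
          generator_dom (P n) (P m u f) /\
          `|generator (P n) (P m u f) - generator (P m) (P m u f)|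
            <= a n m * N f.

Definition cvg_unif_on_compact_times (P : nat -> R -> Z -> Z)
    (Pinf : R -> Z -> Z) : Prop :=
  forall (f : Z) (K : set R), compact K -> K `<=` [set t : R | 0 <= t] ->
    {uniform K, (fun n t => P n t f) @ \oo --> (fun t => Pinf t f)}.

End operators.

Record weightedSpace (R : realType) := WeightedSpace {
  wspace :> topologicalType ;
  weight : wspace -> R ;
  wspace_hausdorff : hausdorff_space wspace ;
  wspace_completely_regular : completely_regular_space wspace ;
  weight_gt0 : forall x, 0 < weight x ;
  weight_admissible : forall r : R, 0 < r -> compact [set x | weight x <= r] }.

Section Brho.
Context {R : realType} (X : weightedSpace R).

Definition weighted_values (f : X -> R) : set R :=
  range (fun x => (weight x)^-1 * `|f x|).

Definition weight_bounded : {pred X -> R} :=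
  mem [set f | has_ubound (weighted_values f)].

Lemma weight_boundedP (f : X -> R) : f \in weight_bounded <->
  exists C : R, forall x, (weight x)^-1 * `|f x| <= C.
Proof.
rewrite inE /=; split=> [[C Cub]|[C fC]]; exists C.
  by move=> x; apply: Cub; exists x.
by move=> _ [x _ <-].
Qed.

Lemma weight_bounded_submod_closed : submod_closed weight_bounded.
Proof.
split.
  apply/weight_boundedP; exists 0 => x.
  by rewrite (_ : (0 : X -> R) x = 0)// normr0 mulr0.
move=> a f g /weight_boundedP[C fC] /weight_boundedP[C' gC'].
apply/weight_boundedP; exists (`|a| * C + C') => x.
rewrite (_ : (a *: f + g) x = a * f x + g x)//.
have w0 : 0 <= (weight x)^-1 by rewrite invr_ge0 ltW// weight_gt0.
apply: (@le_trans _ _ ((weight x)^-1 * (`|a| * `|f x| + `|g x|))).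
  by rewrite ler_wpM2l// (le_trans (ler_normD _ _))// normrM.
by rewrite mulrDr lerD// mulrCA ler_wpM2l.
Qed.

HB.instance Definition _ :=
  GRing.isSubmodClosed.Build R (X -> R) weight_bounded
    weight_bounded_submod_closed.

Record Brho := MkBrho {
  Brho_fun :> X -> R ; BrhoP : Brho_fun \in weight_bounded }.

HB.instance Definition _ := [isSub for Brho_fun].
HB.instance Definition _ := [Choice of Brho by <:].
HB.instance Definition _ := [SubChoice_isSubLmodule of Brho by <:].

Definition Brho_norm (f : Brho) : R := sup (weighted_values f).

Lemma Brho_norm_ub (f : Brho) x : (weight x)^-1 * `|f x| <= Brho_norm f.
Proof.
have /weight_boundedP[C fC] := BrhoP f.
apply: ub_le_sup; last by exists x.
by exists C => _ [y _ <-].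
Qed.

Lemma Brho_norm_ge0 (f : Brho) : 0 <= Brho_norm f.
Proof.
have [[x _]|X0] := pselect ([set: X] !=set0).
  apply: le_trans (Brho_norm_ub f x).
  by rewrite mulr_ge0// invr_ge0 ltW// weight_gt0.
rewrite /Brho_norm (_ : weighted_values f = set0) ?sup0//.
by rewrite -subset0 => y [x _ _]; apply: X0; exists x.
Qed.

Lemma Brho_norm_le (f : Brho) C : 0 <= C ->
  (forall x, (weight x)^-1 * `|f x| <= C) -> Brho_norm f <= C.
Proof.
move=> C0 fC.
have [[x _]|X0] := pselect ([set: X] !=set0).
  apply: ge_sup; first by exists ((weight x)^-1 * `|f x|); exists x.
  by move=> _ [y _ <-].
rewrite /Brho_norm (_ : weighted_values f = set0) ?sup0//.
by rewrite -subset0 => y [x _ _]; apply: X0; exists x.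
Qed.

Lemma Brho_fun_le (f : Brho) x : `|f x| <= weight x * Brho_norm f.
Proof. by rewrite -ler_pdivrMl ?weight_gt0// Brho_norm_ub. Qed.

Lemma Brho_normD (f g : Brho) : Brho_norm (f + g) <= Brho_norm f + Brho_norm g.
Proof.
apply: Brho_norm_le => [|x]; first by rewrite addr_ge0// Brho_norm_ge0.
apply: le_trans (lerD (Brho_norm_ub f x) (Brho_norm_ub g x)).
by rewrite -mulrDr ler_wpM2l ?ler_normD// invr_ge0 ltW// weight_gt0.
Qed.

Lemma Brho_normZ (a : R) (f : Brho) : Brho_norm (a *: f) = `|a| * Brho_norm f.
Proof.
have le_normZ c (g : Brho) : Brho_norm (c *: g) <= `|c| * Brho_norm g.
  apply: Brho_norm_le => [|x]; first by rewrite mulr_ge0// Brho_norm_ge0.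
  by rewrite (_ : (c *: g) x = c * g x)// normrM mulrCA ler_wpM2l// Brho_norm_ub.
apply/eqP; rewrite eq_le le_normZ/=.
have [->|a0] := eqVneq a 0; first by rewrite normr0 mul0r Brho_norm_ge0.
rewrite -ler_pdivlMl ?normr_gt0// -normfV.
by rewrite -[X in Brho_norm X <= _](scalerK a0) le_normZ.
Qed.

Lemma Brho_norm0_eq0 (f : Brho) : Brho_norm f = 0 -> f = 0.
Proof.
move=> f0; apply/val_inj/funext => x /=; apply/normr0_eq0/le_anti.
by rewrite normr_ge0 (le_trans (Brho_fun_le f x))// f0 mulr0.
Qed.

HB.instance Definition _ :=
  Lmodule_isNormed.Build R Brho Brho_normD Brho_normZ Brho_norm0_eq0.

Lemma Brho_normE (f : Brho) : `|f| = sup (weighted_values f).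
Proof. by []. Qed.

Lemma Brho_complete (F : set_system Brho) :
  ProperFilter F -> cauchy F -> cvg F.
Proof.
move=> FF /cauchy_ballP Fc.
have Fx x : cvg ((fun f : Brho => f x) @ F).
  apply/cauchy_cvgP/cauchy_ballP => e e0.
  have := Fc (e / weight x) (divr_gt0 e0 (weight_gt0 x)).
  rewrite !near_simpl => -[[A B] [/= FA FB] AB].
  exists ((fun f : Brho => f x) @` A, (fun f : Brho => f x) @` B).
    split => /=; [apply: filterS FA|apply: filterS FB] => f Af; exact: imageP.
  move=> [_ _] [/= [f Af <-] [g Bg <-]].
  have := AB (f, g) (conj Af Bg).
  rewrite /= -!ball_normE/= => fg.
  apply: le_lt_trans (Brho_fun_le (f - g) x) _.
  by rewrite mulrC -ltr_pdivlMr ?weight_gt0.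
pose h x := lim ((fun f : Brho => f x) @ F).
have hP e : 0 < e ->
    \forall f \near F, forall x, (weight x)^-1 * `|h x - (f : Brho) x| <= e.
  move=> e0.
  have := Fc e e0; rewrite !near_simpl => -[[A B] [/= FA FB] AB].
  apply: filterS FB => g Bg x.
  rewrite ler_pdivrMl ?weight_gt0//.
  have cg : `|f x - g x| @[f --> F] --> `|h x - g x|.
    have Fhx : (f : Brho) x @[f --> F] --> h x by exact: Fx.
    exact: cvg_norm (cvgB Fhx (cvg_cst _)).
  apply: (cvgr_to_le cg).
  apply: filterS FA => f Af.
  have := AB (f, g) (conj Af Bg); rewrite /= -ball_normE/= => fg.
  by rewrite (le_trans (Brho_fun_le (f - g) x))// ler_wpM2l// ltW// weight_gt0.
have hB : h \in weight_bounded.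
  have [g hg] := filter_ex (hP 1 ltr01).
  apply/weight_boundedP; exists (1 + `|g|) => x.
  rewrite -(subrK (g x) (h x)).
  apply: (@le_trans _ _ ((weight x)^-1 * (`|h x - g x| + `|g x|))).
    by rewrite ler_wpM2l ?ler_normD// invr_ge0 ltW// weight_gt0.
  by rewrite mulrDr lerD// Brho_norm_ub.
apply/cvg_ex; exists (MkBrho hB); apply/cvgrPdist_le => e e0.
apply: filterS (hP _ e0) => f fh.
by apply: Brho_norm_le (ltW e0) _.
Qed.

HB.instance Definition _ := Uniform_isComplete.Build Brho Brho_complete.

Definition Cb : set Brho :=
  [set f : Brho | continuous (f : X -> R) /\
                  exists C : R, forall x, `|f x| <= C].

(* The intersection with B^rho in [Cb] loses nothing: C_b(X) lies in B^rho(X),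
   because an admissible weight is bounded away from 0. *)
Lemma weight_bounded_below : exists2 c : R, 0 < c & forall x : X, c <= weight x.
Proof.
apply: contrapT => nc.
pose K (r : R) := [set x : X | weight x <= r].
have K0 r : 0 < r -> K r !=set0.
  move=> r0; apply: contrapT => Kr; apply: nc; exists r => // x.
  by rewrite leNgt; apply/negP => /ltW xr; apply: Kr; exists x.
have B : ProperFilter (filter_from [set r : R | 0 < r] K).
  apply: filter_from_proper => //; apply: filter_from_filter.
    by exists 1 => /=.
  move=> r s /= r0 s0; exists (Num.min r s) => /=.
    by rewrite lt_min r0.
  by move=> x; rewrite /K /= le_min => /andP[].
have [|x [_ clx]] := @weight_admissible R X 1 ltr01 _ B.
  by exists 1 => /=.
pose r := weight x / 2.
have r0 : 0 < r by rewrite divr_gt0// weight_gt0.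
have clK : closed (K r).
  exact: (compact_closed (@wspace_hausdorff R X) (weight_admissible r0)).
have oK : nbhs x (~` K r).
  apply: open_nbhs_nbhs; split; first exact: closed_openC.
  rewrite /K /=; apply/negP; rewrite -ltNge.
  by rewrite /r ltr_pdivrMr// ltr_pMr ?weight_gt0// ltr1n.
have FK : filter_from [set r : R | 0 < r] K (K r) by exists r.
by have [y [Ky]] := clx _ _ FK oK.
Qed.

Lemma bounded_weight_bounded (f : X -> R) :
  (exists C : R, forall x, `|f x| <= C) -> f \in weight_bounded.
Proof.
move=> [C fC]; have [c c0 cw] := weight_bounded_below.
apply/weight_boundedP; exists (c^-1 * C) => x.
by rewrite ler_pM ?invr_ge0 ?(ltW (weight_gt0 x))// lef_pV2 ?posrE ?weight_gt0.
Qed.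

Lemma closure_CbP (f : Brho) :
  closure Cb f <-> forall e, 0 < e -> exists2 g, Cb g & `|f - g| < e.
Proof.
split=> [clf e e0|clf A /nbhs_ballP[e /= e0 eA]].
  have [g [Cg]] := clf _ (nbhsx_ballx f e e0).
  by rewrite -ball_normE/=; exists g.
have [g Cg fg] := clf e e0.
by exists g; split => //; apply: eA; rewrite -ball_normE.
Qed.

Definition in_calBrho : {pred Brho} := mem (closure Cb).

Lemma in_calBrho_submod_closed : submod_closed in_calBrho.
Proof.
split.
  rewrite inE; apply: subset_closure; split.
    by move=> x; exact: cvg_cst.
  by exists 0 => x; rewrite (_ : (0 : Brho) x = 0)// normr0.
move=> a f g; rewrite !inE => /closure_CbP clf /closure_CbP clg.
apply/closure_CbP => e e0.
have a0 : 0 < `|a| + 1 by rewrite ltr_wpDl.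
have d0 : 0 < e / (2 * (`|a| + 1)) by rewrite divr_gt0// mulr_gt0.
have e20 : 0 < e / 2 by rewrite divr_gt0.
have [f' [f'c [C f'C]] ff'] := clf _ d0.
have [g' [g'c [C' g'C']] gg'] := clg _ e20.
exists (a *: f' + g').
  split.
    move=> x; rewrite (_ : (a *: f' + g' : X -> R) = (fun y => a * f' y + g' y))//.
    by apply: cvgD; [apply: cvgMr; exact: f'c|exact: g'c].
  exists (`|a| * C + C') => x.
  rewrite (_ : (a *: f' + g') x = a * f' x + g' x)//.
  by rewrite (le_trans (ler_normD _ _))// lerD// normrM ler_wpM2l.
rewrite opprD addrACA -scalerBr (splitr e).
rewrite (le_lt_trans (ler_normD _ _))// normrZ ler_ltD//.
rewrite (le_trans (ler_wpM2l _ (ltW ff')))//.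
rewrite invfM [e * (_ * _)]mulrA mulrCA ler_piMr ?(ltW e20)//.
by rewrite ler_pdivrMr ?mul1r ?lerDl// ltr_wpDl.
Qed.

HB.instance Definition _ :=
  GRing.isSubmodClosed.Build R Brho in_calBrho in_calBrho_submod_closed.

Record calBrho := MkCalBrho {
  calBrho_fun :> Brho ; calBrhoP : calBrho_fun \in in_calBrho }.

HB.instance Definition _ := [isSub for calBrho_fun].
HB.instance Definition _ := [Choice of calBrho by <:].
HB.instance Definition _ := [SubChoice_isSubLmodule of calBrho by <:].

Definition calBrho_norm (f : calBrho) : R := `|f : Brho|.

Lemma calBrho_normD (f g : calBrho) :
  calBrho_norm (f + g) <= calBrho_norm f + calBrho_norm g.
Proof. exact: ler_normD. Qed.

Lemma calBrho_normZ (a : R) (f : calBrho) :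
  calBrho_norm (a *: f) = `|a| * calBrho_norm f.
Proof. exact: normrZ. Qed.

Lemma calBrho_norm0_eq0 (f : calBrho) : calBrho_norm f = 0 -> f = 0.
Proof. by move=> /normr0_eq0 f0; exact: val_inj. Qed.

HB.instance Definition _ :=
  Lmodule_isNormed.Build R calBrho calBrho_normD calBrho_normZ
    calBrho_norm0_eq0.

Lemma calBrho_normE (f : calBrho) : `|f| = `|f : Brho|.
Proof. by []. Qed.

Lemma calBrho_complete (F : set_system calBrho) :
  ProperFilter F -> cauchy F -> cvg F.
Proof.
move=> FF /cauchy_ballP Fc.
have : cvg (calBrho_fun @ F).
  apply/cauchy_cvgP/cauchy_ballP => e e0.
  have := Fc e e0.
  rewrite !near_simpl => -[[A B] [/= FA FB] AB].
  exists (calBrho_fun @` A, calBrho_fun @` B).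
    by split => /=; [apply: filterS FA|apply: filterS FB] => f Af; exact: imageP.
  move=> [_ _] [/= [f Af <-] [g Bg <-]].
  by have := AB (f, g) (conj Af Bg); rewrite /= -!ball_normE.
move=> /cvg_ex[h Fh].
have hC : h \in in_calBrho.
  rewrite inE; apply: (closed_cvg _ (@closed_closure _ Cb) _ _ Fh).
  by near=> f; have := calBrhoP f; rewrite inE.
apply/cvg_ex; exists (MkCalBrho hC); apply/cvgrPdist_lt => e e0.
by move/cvgrPdist_lt : Fh => /(_ e e0); apply: filterS => f; exact.
Unshelve. all: by end_near. Qed.

HB.instance Definition _ := Uniform_isComplete.Build calBrho calBrho_complete.

Definition generalized_Feller (P : R -> calBrho -> calBrho) : Prop :=
  [/\ operator_semigroup P,
      forall (f : calBrho) (x : X), P t f x @[t --> 0^'+] --> f x,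
      exists (C eps : R), 0 < eps /\
        forall t : R, 0 <= t <= eps -> (opnorm (P t) <= C%:E)%E &
      forall (t : R) (f : calBrho), 0 <= t ->
        (forall x, 0 <= f x) -> forall x, 0 <= P t f x].

End Brho.

(* Main.v *)
Require Import Defs.
From mathcomp Require Import all_boot all_order all_algebra.
From mathcomp Require Import all_classical all_reals all_analysis.
From mathcomp Require Import lra.
Import Order.TTheory GRing.Theory Num.Theory.
Import numFieldNormedType.Exports.
Local Open Scope classical_set_scope.
Local Open Scope ring_scope.

(** Comparing two semigroups [P] and [Q] along an orbit of [Q]: the curve
  [phi u = P (t - u) (Q u f)] joins [P t f] to [Q t f], and formally
  [phi' u = P (t - u) (B - A) (Q u f)], where [A] and [B] are the generators
  of [P] and [Q]. So [P t f - Q t f] is at most [M e^(|omega| t)] times [t]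
  times the largest distance between [A] and [B] on the orbit [Q u f],
  [0 <= u <= t] ([semigroup_sub_le]).

  The usual way to conclude from [phi'] integrates it. A mean value inequality
  does the same work with less: it is enough that [phi] is left continuous and
  that its increments over small steps to the right are bounded by a constant
  times the step ([mean_value_right_slope]). Both follow from algebra, since
  [phi (u + h) - phi u] is [P (t - u - h)] applied to [Q h g - P h g], with
  [g = Q u f] ([semigroup_swap_step]); no continuity of the map
  [u |-> A (Q u f)] is involved.

  Applied to [P n] and [P m], this makes [n |-> P n t f] Cauchy, uniformly for
  [t] in a segment [[0, T]], for every [f] in [D]. That property passes to
  [lspan D] because the [P n t] are linear, and then to the whole space because
  they are bounded uniformly in [n] and in [t <= T] ([unif_Cauchy_dense]). By
  completeness the limit exists. The semigroup law, the growth bound and strong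
  continuity survive the limit: the first two pointwise in time, the last one
  because convergence is uniform on [[0, 1]].

  On [calBrho X] evaluation at a point is continuous, so positivity and
  pointwise continuity at time [0] are inherited as well. *)

(** * The operator norm and a mean value inequality *)

Lemma opnorm_le (R : realType) (Z : normedModType R) (T : Z -> Z) (C : R) :
  linear T -> 0 <= C ->
  (opnorm T <= C%:E)%E <-> forall z, `|T z| <= C * `|z|.
Proof.
move=> linT C0.
have T0 : T 0 = 0.
  have := linT 1 0 0; rewrite !scale1r addr0.
  by move/(congr1 (fun x => x - T 0)); rewrite subrr addrK.
have TZ a z : T (a *: z) = a *: T z.
  by have := linT a z 0; rewrite !addr0 T0 addr0.
split=> [TC z|TC]; last first.
  apply: ge_ereal_sup => _ [z /= z1 <-]; rewrite lee_fin.
  by rewrite (le_trans (TC z))// ler_piMr.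
have [->|z0] := eqVneq z 0.
  by rewrite T0 !normr0 mulr0.
have nz : 0 < `|z| by rewrite normr_gt0.
have : (`|T (`|z|^-1 *: z)|%:E <= C%:E)%E.
  apply: le_trans TC; apply: ereal_sup_ubound; exists (`|z|^-1 *: z) => //=.
  by rewrite normrZ normfV normr_id mulVf// gt_eqF.
by rewrite lee_fin TZ normrZ normfV normr_id ler_pdivrMl// mulrC.
Qed.

(** The set of the [s] with [`|phi s - phi 0| <= C * s] contains its supremum,
  by left continuity, and the slope bound lets one go beyond any of its points
  smaller than [t]. Only slopes to the right are asked for, because the
  generator of a semigroup is a one-sided derivative. *)
Lemma mean_value_right_slope (R : realType) (Z : normedModType R)
    (phi : R -> Z) (t C : R) :
  0 <= t -> 0 <= C ->
  (forall s, 0 < s <= t -> phi x @[x --> s^'-] --> phi s) ->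
  (forall s, 0 <= s < t ->
     \forall h \near 0^'+, `|phi (s + h) - phi s| <= C * h) ->
  `|phi t - phi 0| <= C * t.
Proof.
move=> t0 C0 leftc slope.
pose S := [set s : R | 0 <= s <= t /\ `|phi s - phi 0| <= C * s].
have S0 : S 0 by split; rewrite ?lexx ?t0// subrr normr0 mulr0.
have ubS : ubound S t by move=> s [/andP[]].
have supS : has_sup S by split; [exists 0|exists t].
pose c := sup S.
have c0 : 0 <= c by apply: ub_le_sup => //; exists t.
have ct : c <= t by apply: ge_sup => //; exists 0.
have Sc : S c.
  have [c_eq0|cn0] := eqVneq c 0; first by rewrite c_eq0.
  have cgt0 : 0 < c by rewrite lt0r cn0.
  split; first by rewrite c0.
  apply/ler_addgt0Pr => e e0.
  have /cvgrPdist_le/(_ e e0) : phi x @[x --> c^'-] --> phi c.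
    by apply: leftc; rewrite cgt0.
  move=> /nbhs_ballP[d /= d0 near_c].
  have [s Ss cds] := sup_adherent d0 supS.
  have sc : s <= c by apply: ub_le_sup => //; exists t.
  have Cs : C * s <= C * c by exact: ler_wpM2l.
  have [_ phis] := Ss.
  have [<-|nsc] := eqVneq s c; first by rewrite (le_trans phis)// lerDl ltW.
  have scl : s < c by rewrite lt_neqAle nsc.
  have := near_c s; rewrite /ball/= ger0_norm ?subr_ge0// => /(_ _ scl) phics.
  have -> : phi c - phi 0 = (phi c - phi s) + (phi s - phi 0).
    by rewrite addrA subrK.
  rewrite (le_trans (ler_normD _ _))// addrC lerD ?(le_trans phis)//.
  by apply: phics; rewrite ltrBlDr -ltrBlDl.
have [->//|nct] := eqVneq t c; first exact: (proj2 Sc).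
have {nct}ct' : c < t by rewrite lt_neqAle eq_sym nct.
near (0:R)^'+ => h.
have h0 : 0 < h by near: h; exact: nbhs_right_gt.
have Sch : S (c + h).
  split.
    rewrite addr_ge0 ?(ltW h0)//= -lerBrDl.
    by near: h; apply: nbhs_right_le; rewrite subr_gt0.
  have -> : phi (c + h) - phi 0 = (phi (c + h) - phi c) + (phi c - phi 0).
    by rewrite addrA subrK.
  rewrite (le_trans (ler_normD _ _))// mulrDr addrC lerD ?(proj2 Sc)//.
  by near: h; apply: slope; rewrite c0.
have : c + h <= c by apply: ub_le_sup => //; exists t.
by rewrite gerDl leNgt h0.
Unshelve. all: by end_near. Qed.

(** * Two semigroups compared along an orbit *)

Section bounded_semigroups.
Context {R : realType} {Z : normedModType R}.
Implicit Types (P Q : R -> Z -> Z) (M omega t u h : R) (f z : Z).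

Lemma semigroupB P t y z : operator_semigroup P -> 0 <= t ->
  P t (y - z) = P t y - P t z.
Proof.
move=> [bP _ _] /bP[linP _]; have := linP (-1) z y.
by rewrite !scaleN1r [- z + y]addrC => ->; rewrite addrC.
Qed.

(** The absolute value makes the bound monotone in time whatever the sign of
  [omega], so that one constant serves on the whole segment [[0, T]]. *)
Lemma growth_bound_segment P M omega T : 1 <= M -> operator_semigroup P ->
  growth_bound M omega P ->
  forall t z, 0 <= t <= T -> `|P t z| <= M * expR (`|omega| * T) * `|z|.
Proof.
move=> M1 [bP _ _] gP t z /andP[t0 tT].
have M0 : 0 <= M by exact: le_trans M1.
have [linP _] := bP t t0.
have /(opnorm_le _ _) := gP t t0.
rewrite mulr_ge0 ?expR_ge0// => /(_ linP isT) /(_ z) /le_trans; apply.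
rewrite ler_wpM2r// ler_wpM2l// ler_expR.
by rewrite (le_trans (ler_wpM2r t0 (ler_norm omega)))// ler_wpM2l.
Qed.

(** An increment of [u |-> P (t - u) (Q u f)] exchanges one step of length [h]
  of [P] for one of [Q], at the point [Q u f]. *)
Lemma semigroup_swap_step P Q t u h f :
  operator_semigroup P -> operator_semigroup Q ->
  0 <= u -> 0 <= h -> u + h <= t ->
  P (t - (u + h)) (Q (u + h) f) - P (t - u) (Q u f) =
  P (t - (u + h)) (Q h (Q u f) - P h (Q u f)).
Proof.
move=> sP sQ u0 h0 uht.
have r0 : 0 <= t - (u + h) by rewrite subr_ge0.
have [_ _ PD] := sP; have [_ _ QD] := sQ.
rewrite semigroupB// -PD// -QD//; congr (P _ _ - P _ _).
  by rewrite addrC.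
by rewrite opprD addrA subrK.
Qed.

Lemma generator_right_slope P z e : generator_dom P z -> 0 < e ->
  \forall h \near 0^'+, `|P h z - z - h *: generator P z| <= e * h.
Proof.
move=> domz e0; have /cvgrPdist_le/(_ e e0) := domz.
rewrite -/(generator P z) => near_gen; near=> h.
have h0 : 0 < h by near: h; exact: nbhs_right_gt.
have -> : P h z - z - h *: generator P z =
    - h *: (generator P z - h^-1 *: (P h z - z)).
  by rewrite scalerBr !scaleNr scalerA divff ?gt_eqF// scale1r opprK addrC.
rewrite normrZ normrN gtr0_norm// mulrC ler_wpM2r ?(ltW h0)//.
by near: h.
Unshelve. all: by end_near. Qed.

(** Duhamel's formula
  [P t f - Q t f = \int_0^t P (t - u) (A - B) (Q u f) du] as an inequality,
  obtained from the mean value inequality for [u |-> P (t - u) (Q u f)]. The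
  bound by [d] is strict because the right increments over [h] are controlled
  only up to [o(h)], which the slack absorbs. *)
Lemma semigroup_sub_le P Q M omega t d f : 1 <= M -> 0 <= t -> 0 < d ->
  C0_semigroup P -> C0_semigroup Q ->
  growth_bound M omega P -> growth_bound M omega Q ->
  (forall u, 0 <= u <= t ->
     [/\ generator_dom P (Q u f), generator_dom Q (Q u f) &
         `|generator P (Q u f) - generator Q (Q u f)| < d]) ->
  `|P t f - Q t f| <= M * expR (`|omega| * t) * d * t.
Proof.
move=> M1 t0 d0 [sP cP] [sQ cQ] gP gQ genPQ.
pose K := M * expR (`|omega| * t).
have K0 : 0 <= K by rewrite mulr_ge0 ?expR_ge0// (le_trans _ M1).
have PK u z : 0 <= u <= t -> `|P u z| <= K * `|z|.
  exact: growth_bound_segment.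
have QK u z : 0 <= u <= t -> `|Q u z| <= K * `|z|.
  exact: growth_bound_segment.
have [_ P0 PD] := sP; have [_ Q0 QD] := sQ.
pose phi u := P (t - u) (Q u f).
have -> : P t f - Q t f = - (phi t - phi 0).
  by rewrite /phi subrr P0 subr0 Q0 opprB.
rewrite normrN; apply: mean_value_right_slope => //.
- by rewrite mulr_ge0// ltW.
- move=> s /andP[s0 st].
  (* The orbit [Q (s - h) f] moves with [h], but at distance at most
     [K * `|Q h f - f|] from [Q s f]; hence this bound for
     [`|phi s - phi (s - h)|]. *)
  have lim0 : K * (`|P h (Q s f) - Q s f| + K * (K * `|Q h f - f|))
      @[h --> 0^'+] --> (0 : R).
    have cvg0 (W : R -> Z -> Z) (g : Z) : W h g @[h --> 0^'+] --> g ->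
        `|W h g - g| @[h --> 0^'+] --> (0 : R).
      by move=> /cvgB/(_ (cvg_cst g))/cvg_norm; rewrite subrr normr0.
    suff : K * (`|P h (Q s f) - Q s f| + K * (K * `|Q h f - f|))
        @[h --> 0^'+] --> K * (0 + K * (K * 0)) by rewrite !mulr0 addr0 mulr0.
    apply: cvgMr; apply: cvgD; first exact: (cvg0 P _ (cP _)).
    by do 2!apply: cvgMr; exact: (cvg0 Q _ (cQ _)).
  apply/cvgrPdist_le => e e0; apply/nbhs_left0P.
  move/cvgrPdist_le : lim0 => /(_ e e0) lim0; near=> h.
  have h0 : 0 < h by near: h; exact: nbhs_right_gt.
  have hs : h <= s by near: h; exact: nbhs_right_le.
  have : `|0 - K * (`|P h (Q s f) - Q s f| + K * (K * `|Q h f - f|))| <= e.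
    by near: h.
  rewrite sub0r normrN; apply: le_trans; apply: le_trans (ler_norm _).
  have sh0 : 0 <= s - h by rewrite subr_ge0.
  have ht : 0 <= h <= t by rewrite ltW//= (le_trans hs).
  have Qdiff : `|Q s f - Q (s - h) f| <= K * `|Q h f - f|.
    rewrite -[in Q s f](subrK h s) QD ?(ltW h0)// -semigroupB//.
    by rewrite QK// sh0 (le_trans _ st)// gerBl ltW.
  have := @semigroup_swap_step P Q t (s - h) h f sP sQ.
  rewrite sh0 (ltW h0) subrK st => /(_ isT isT isT) swap.
  rewrite /phi swap (le_trans (PK _ _ _)) ?subr_ge0 ?st ?gerBl ?(ltW s0)//.
  rewrite ler_wpM2l// -QD ?(ltW h0)// subrKC.
  have -> : Q s f - P h (Q (s - h) f) =
      P h (Q s f - Q (s - h) f) - (P h (Q s f) - Q s f).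
    rewrite semigroupB ?(ltW h0)// opprB.
    by rewrite [RHS]addrC addrA subrK.
  rewrite (le_trans (ler_normB _ _))// addrC lerD2l (le_trans (PK _ _ ht))//.
  by rewrite ler_wpM2l.
- move=> s /andP[s0 st].
  have [domP domQ] := genPQ s (introT andP (conj s0 (ltW st))).
  rewrite -subr_gt0.
  (* Half of the slack pays for the remainder of each difference quotient. *)
  set e := d - _ => e0.
  have e20 : 0 < e / 2 by rewrite divr_gt0.
  near=> h.
  have h0 : 0 < h by near: h; exact: nbhs_right_gt.
  have hts : h <= t - s by near: h; apply: nbhs_right_le; rewrite subr_gt0.
  have sht : s + h <= t by rewrite -lerBrDl.
  rewrite /phi (semigroup_swap_step _ _ _ _ _ f sP sQ s0 (ltW h0) sht).
  rewrite (le_trans (PK _ _ _)) ?subr_ge0 ?sht ?gerBl ?addr_ge0 ?(ltW h0)//.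
  rewrite -mulrA ler_wpM2l//.
  have Ph : `|P h (Q s f) - Q s f - h *: generator P (Q s f)| <= e / 2 * h.
    by near: h; exact: generator_right_slope.
  have Qh : `|Q h (Q s f) - Q s f - h *: generator Q (Q s f)| <= e / 2 * h.
    by near: h; exact: generator_right_slope.
  set g := Q s f in Ph Qh *; set A := generator P g in Ph e0 *.
  set B := generator Q g in Qh e0 *.
  have -> : Q h g - P h g =
      (Q h g - g - h *: B) - (P h g - g - h *: A) - h *: (A - B).
    rewrite scalerBr [- (h *: A - _)]opprB addrACA subrK -opprD subrK.
    by rewrite opprB addrA subrK.
  have -> : d * h = e / 2 * h + e / 2 * h + h * `|A - B|.
    by rewrite -mulrDl -splitr /e [h * _]mulrC -mulrDl subrK.
  rewrite (le_trans (ler_normB _ _))// lerD ?normrZ ?gtr0_norm//.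
  by rewrite (le_trans (ler_normB _ _))// lerD.
Unshelve. all: by end_near. Qed.
End bounded_semigroups.

(** * Uniform Cauchy sequences of semigroups *)

Section limit_semigroup.
Context {R : realType} {Z : normedModType R}.
Variables (P : nat -> R -> Z -> Z) (M omega : R).
Hypotheses (M1 : 1 <= M) (C0P : forall n, C0_semigroup (P n)).
Hypothesis gP : forall n, growth_bound M omega (P n).

Let sP n : operator_semigroup (P n) := (C0P n).1.

Let growth_sup (T : R) := M * expR (`|omega| * T).

Let growth_sup_gt0 T : 0 < growth_sup T.
Proof. by rewrite mulr_gt0 ?expR_gt0// (lt_le_trans ltr01). Qed.

Let growth_supP n T t z : 0 <= t <= T -> `|P n t z| <= growth_sup T * `|z|.
Proof. exact: growth_bound_segment. Qed.

Definition unif_Cauchy_on_segments (z : Z) :=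
  forall T e : R, 0 < T -> 0 < e ->
    \forall n \near \oo & m \near \oo,
      forall t, 0 <= t <= T -> `|P n t z - P m t z| <= e.

Definition unif_cvg_on_segments (Pinf : R -> Z -> Z) :=
  forall (z : Z) (T e : R), 0 < T -> 0 < e ->
    \forall n \near \oo, forall t, 0 <= t <= T -> `|Pinf t z - P n t z| <= e.

Lemma unif_Cauchy_generators_Cauchy (D : set Z) :
  generators_Cauchy_on D P -> forall z, D z -> unif_Cauchy_on_segments z.
Proof.
move=> [N _ genP] z Dz T e T0 e0.
have KT0 : 0 < growth_sup T * T by rewrite mulr_gt0.
pose d := e / (growth_sup T * T).
have d0 : 0 < d by rewrite divr_gt0.
have [a a0 gen_le] := genP z T Dz T0.
have : a nm.1 nm.2 * N z @[nm --> (\oo, \oo)] --> (0 : R).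
  by rewrite -[X in _ --> X](mul0r (N z)); apply: cvgMl.
move=> /cvgrPdist_lt/(_ d d0) near_a.
apply: filterS near_a => -[n m] /= anm t /andP[t0 tT].
have : `|P n t z - P m t z| <= M * expR (`|omega| * t) * d * t.
  apply: semigroup_sub_le => // u /andP[u0 ut].
  have uT : 0 <= u <= T by rewrite u0 (le_trans ut).
  have [domn gen_nm] := gen_le n m u uT.
  split=> //; first by have [] := gen_le m m u uT.
  by rewrite (le_lt_trans gen_nm)// (le_lt_trans (ler_norm _))// -normrN -sub0r.
move=> /le_trans; apply.
have M0 : 0 <= M by exact: le_trans M1.
have d0' := ltW d0.
apply: (@le_trans _ _ (growth_sup T * d * T)).
  apply: ler_pM => //; first by do 2!rewrite mulr_ge0 ?expR_ge0//.
  by rewrite ler_wpM2r// ler_wpM2l// ler_expR ler_wpM2l.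
by rewrite mulrAC /d mulrCA divff ?gt_eqF// mulr1.
Qed.

Lemma unif_Cauchy_lspan (D : set Z) :
  (forall z, D z -> unif_Cauchy_on_segments z) ->
  forall z, lspan D z -> unif_Cauchy_on_segments z.
Proof.
move=> CD z [k [c [d [Dd ->]]]].
elim/big_rec : _ => [|i x _ Cx] T e T0 e0.
  exists (setT, setT) => [|[n m] _ /= t /andP[t0 _]].
    by split; exact: filterT.
  by rewrite -(subrr (0 : Z)) !semigroupB// !subrr normr0 ltW.
have c0 : 0 < `|c i| + 1 by rewrite ltr_wpDl.
have e1 : 0 < e / 2 / (`|c i| + 1) by rewrite !divr_gt0.
have e2 : 0 < e / 2 by rewrite divr_gt0.
apply: filterS2 (CD _ (Dd i) _ _ T0 e1) (Cx _ _ T0 e2).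
move=> -[n m] /= Ci Cnm t tT; have /andP[t0 _] := tT.
have lin j : P j t (c i *: d i + x) = c i *: P j t (d i) + P j t x.
  by have [bP _ _] := sP j; have [linP _] := bP t t0; exact: linP.
rewrite !lin opprD addrACA -scalerBr (splitr e).
rewrite (le_trans (ler_normD _ _))// lerD//; last exact: Cnm.
rewrite normrZ; apply: (@le_trans _ _ (`|c i| * (e / 2 / (`|c i| + 1)))).
  by rewrite ler_wpM2l// Ci.
by rewrite mulrCA ler_piMr ?(ltW e2)// ler_pdivrMr// mul1r lerDl.
Qed.

(** An [e / 3] argument: the bound [growth_sup T] on the operators depends
  neither on [n] nor on the time in [[0, T]]. *)
Lemma unif_Cauchy_dense (V : set Z) : dense V ->
  (forall z, V z -> unif_Cauchy_on_segments z) ->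
  forall z, unif_Cauchy_on_segments z.
Proof.
move=> dV CV z T e T0 e0.
pose d := e / 4 / growth_sup T.
have d0 : 0 < d by rewrite !divr_gt0.
have [y [/= zy Vy]] : ball z d `&` V !=set0.
  by apply: dV; [exists z; exact: ballxx|exact: ball_open].
move: zy; rewrite -ball_normE/= => /ltW zy.
have e2 : 0 < e / 2 by rewrite divr_gt0.
apply: filterS (CV y Vy _ _ T0 e2) => -[n m] /= Cy t tT.
have /andP[t0 _] := tT.
have Pzy j : `|P j t z - P j t y| <= e / 4.
  rewrite -semigroupB// (le_trans (growth_supP _ _ _ _ tT))//.
  by rewrite -ler_pdivlMl// mulrC.
have -> : P n t z - P m t z = (P n t z - P n t y) + (P n t y - P m t y) -
    (P m t z - P m t y).
  by rewrite addrA subrK opprB addrA subrK.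
rewrite (le_trans (ler_normB _ _))//.
have := ler_normD (P n t z - P n t y) (P n t y - P m t y).
by have := Cy t tT; have := Pzy m; have := Pzy n; lra.
Qed.

(** * Properties of the limit semigroup *)

Section properties_of_limit.
Variable Pinf : R -> Z -> Z.
Hypothesis P_Pinf : unif_cvg_on_segments Pinf.

Lemma unif_cvg_pointwise t z : 0 <= t -> P n t z @[n --> \oo] --> Pinf t z.
Proof.
move=> t0; apply/cvgrPdist_le => e e0.
have t1 : 0 < t + 1 by rewrite ltr_wpDl.
have := P_Pinf z _ _ t1 e0; apply: filterS => n; apply.
by rewrite t0 lerDl ler01.
Qed.

Let linear_Pinf t : 0 <= t -> linear (Pinf t).
Proof.
move=> t0 a y z.
have cvg1 := @unif_cvg_pointwise t (a *: y + z) t0.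
have cvg2 : a *: P n t y + P n t z @[n --> \oo] --> a *: Pinf t y + Pinf t z.
  by apply: cvgD; [apply: cvgZr|]; exact: unif_cvg_pointwise.
apply: (cvg_unique _ cvg1); first exact: norm_hausdorff.
apply: cvg_trans cvg2; apply: near_eq_cvg; apply: nearW => n.
by have [bP _ _] := sP n; have [linP _] := bP t t0; rewrite linP.
Qed.

Lemma limit_growth_bound : growth_bound M omega Pinf.
Proof.
move=> t t0; have K0 : 0 <= M * expR (omega * t).
  by rewrite mulr_ge0 ?expR_ge0// (le_trans _ M1).
apply/opnorm_le => // [|z]; first exact: linear_Pinf.
apply: (cvgr_to_le (cvg_norm (unif_cvg_pointwise t z t0))).
apply: nearW => n; move: z; apply/opnorm_le => //; last exact: gP.
by have [bP _ _] := sP n; have [] := bP t t0.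
Qed.

(** For the semigroup law, both the operator and its argument move with [n] in
  [P n t (P n s z)]; the bound on [P n t], uniform in [n], handles the
  argument. *)
Lemma limit_operator_semigroup : operator_semigroup Pinf.
Proof.
split.
- move=> t t0; split; first exact: linear_Pinf.
  exact: le_lt_trans (limit_growth_bound _ t0) (ltry _).
- move=> z; have cvg0 := unif_cvg_pointwise 0 z (lexx 0).
  apply: (cvg_unique _ cvg0); first exact: norm_hausdorff.
  rewrite (_ : (fun n => P n 0 z) = fun=> z); first exact: cvg_cst.
  by apply/funext => n; have [_ ->] := sP n.
- move=> s t z s0 t0; have st0 := addr_ge0 t0 s0.
  apply: (cvg_unique _ (unif_cvg_pointwise _ z st0)).
    exact: norm_hausdorff.
  have cvg_s := unif_cvg_pointwise s z s0.
  have cvg_t := unif_cvg_pointwise t (Pinf s z) t0.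
  apply/cvgrPdist_le => e e0.
  have e2 : 0 < e / 2 by rewrite divr_gt0.
  have e2K : 0 < e / 2 / growth_sup t by rewrite divr_gt0.
  near=> n.
  have near_t : `|Pinf t (Pinf s z) - P n t (Pinf s z)| <= e / 2.
    by near: n; move/cvgrPdist_le : cvg_t => /(_ _ e2).
  have near_s : `|Pinf s z - P n s z| <= e / 2 / growth_sup t.
    by near: n; move/cvgrPdist_le : cvg_s => /(_ _ e2K).
  have [_ _ ->//] := sP n.
  rewrite -(subrK (P n t (Pinf s z)) (Pinf t _)) -addrA -semigroupB//.
  rewrite (le_trans (ler_normD _ _))// (splitr e) lerD//.
  rewrite (le_trans (growth_supP n t t _ _)) ?t0 ?lexx//.
  by rewrite -ler_pdivlMl// mulrC.
Unshelve. all: by end_near. Qed.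

(** Pointwise convergence would not be enough: one index [n] has to approximate
  the limit at all small times simultaneously. *)
Lemma limit_C0_semigroup : C0_semigroup Pinf.
Proof.
split=> [|z]; first exact: limit_operator_semigroup.
apply/cvgrPdist_le => e e0.
have e2 : 0 < e / 2 by rewrite divr_gt0.
have [n nP] := filter_ex (P_Pinf z 1 (e / 2) ltr01 e2).
have /cvgrPdist_le/(_ _ e2) nC0 := (C0P n).2 z.
near=> t.
have -> : z - Pinf t z = (z - P n t z) + (P n t z - Pinf t z).
  by rewrite addrA subrK.
rewrite (splitr e) (le_trans (ler_normD _ _))// lerD//.
  by near: t.
rewrite distrC nP//; apply/andP; split.
  by near: t; exact: nbhs_right_ge.
by near: t; apply: nbhs_right_le.
Unshelve. all: by end_near. Qed.

Lemma limit_cvg_unif_on_compact_times : cvg_unif_on_compact_times P Pinf.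
Proof.
move=> f K cK K0 A /uniform_nbhs[E [/= + EA]].
rewrite -entourage_ballE => -[e /= e0 eE].
have [r [_ /(_ (`|r| + 1))]] := compact_bounded cK.
rewrite (le_lt_trans (ler_norm r)) ?ltrDl// => /(_ isT) Kr.
have r0 : 0 < `|r| + 1 by rewrite ltr_wpDl.
have e2 : 0 < e / 2 by rewrite divr_gt0.
have := P_Pinf f _ _ r0 e2; apply: filterS => n nP; apply: EA => t Kt.
apply: eE; rewrite /= -ball_normE /=.
rewrite (le_lt_trans (nP t _)) ?(K0 _ Kt)//=; last first.
  by rewrite gtr_pMr// invf_lt1// ltr1n.
by rewrite (le_trans (ler_norm t))// Kr.
Qed.

End properties_of_limit.
End limit_semigroup.

(** * Existence of the limit *)

Lemma unif_Cauchy_limit (R : realType) (Z : completeNormedModType R)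
    (P : nat -> R -> Z -> Z) :
  (forall z, unif_Cauchy_on_segments P z) ->
  exists Pinf, unif_cvg_on_segments P Pinf.
Proof.
move=> CP; exists (fun t z => lim (P n t z @[n --> \oo])) => z T e T0 e0.
have cvgP t : 0 <= t <= T -> cvg (P n t z @[n --> \oo]).
  move=> tT; apply/cauchy_cvgP/cauchy_exP => d d0.
  have d2 : 0 < d / 2 by rewrite divr_gt0.
  have /nearP_dep/filter_ex[n nC] := CP z T (d / 2) T0 d2.
  exists (P n t z); apply: filterS nC => m /(_ t tT).
  rewrite -ball_normE/= => /le_lt_trans; apply.
  by rewrite gtr_pMr// invf_lt1// ltr1n.
have /nearP_dep := CP z T e T0 e0.
apply: filterS => n nC t tT.
have cvgn : `|P m t z - P n t z| @[m --> \oo] -->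
    `|lim (P m t z @[m --> \oo]) - P n t z|.
  by apply: cvg_norm; apply: cvgB; [exact: cvgP|exact: cvg_cst].
apply: (cvgr_to_le cvgn); apply: filterS nC => m /(_ t tT).
by rewrite distrC.
Qed.

Lemma limit_semigroup_exists (R : realType) (Z : completeNormedModType R)
    (P : nat -> R -> Z -> Z) (M omega : R) (D : set Z) :
  1 <= M ->
  (forall n, C0_semigroup (P n)) ->
  (forall n, growth_bound M omega (P n)) ->
  dense (lspan D) ->
  generators_Cauchy_on D P ->
  exists Pinf : R -> Z -> Z,
    [/\ C0_semigroup Pinf, growth_bound M omega Pinf &
        cvg_unif_on_compact_times P Pinf].
Proof.
move=> M1 C0P gP dD genP.
have [|Pinf P_Pinf] := @unif_Cauchy_limit R Z P.
  apply: (unif_Cauchy_dense _ _ _ M1 C0P gP _ dD).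
  apply: unif_Cauchy_lspan => //.
  exact: unif_Cauchy_generators_Cauchy M1 C0P gP _ genP.
exists Pinf; split.
- exact: (limit_C0_semigroup _ _ _ M1 C0P gP).
- exact: (limit_growth_bound _ _ _ M1 C0P).
- exact: limit_cvg_unif_on_compact_times.
Qed.

(** * Generalized Feller semigroups *)

Lemma cvg_calBrho_pointwise (R : realType) (X : weightedSpace R) (T : Type)
    (F : set_system T) (g : T -> calBrho X) (h : calBrho X) (x : X) :
  Filter F -> g @ F --> h -> (g y : calBrho X) x @[y --> F] --> h x.
Proof.
move=> FF gh; apply/cvgrPdist_le => e e0.
have ew : 0 < e / weight x by rewrite divr_gt0// weight_gt0.
move/cvgrPdist_le : gh => /(_ _ ew); apply: filterS => y.
rewrite ler_pdivlMr ?weight_gt0// mulrC; apply: le_trans.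
exact: (Brho_fun_le (calBrho_fun (h - g y)) x).
Qed.

(** The nonnegative functions form a set closed under pointwise convergence, and
  convergence uniform on compacts in time contains convergence at each time. *)
Lemma generalized_Feller_limit (R : realType) (X : weightedSpace R)
    (P : nat -> R -> calBrho X -> calBrho X)
    (Pinf : R -> calBrho X -> calBrho X)
    (M omega : R) :
  1 <= M -> C0_semigroup Pinf -> growth_bound M omega Pinf ->
  cvg_unif_on_compact_times P Pinf ->
  (forall n, generalized_Feller (P n)) -> generalized_Feller Pinf.
Proof.
move=> M1 [sPinf C0Pinf] gPinf P_Pinf FP.
split=> //.
- by move=> f x; apply: cvg_calBrho_pointwise; exact: C0Pinf.
- exists (M * expR `|omega|), 1; split=> // t /andP[t0 t1].
  have [bP _ _] := sPinf; have [linP _] := bP t t0.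
  apply/opnorm_le => // [|z].
    by rewrite mulr_ge0 ?expR_ge0// (le_trans _ M1).
  rewrite -[`|omega|]mulr1.
  by apply: growth_bound_segment; rewrite ?t0.
- move=> t f t0 f0 x.
  have Pt : P n t f @[n --> \oo] --> Pinf t f.
    have := P_Pinf f [set t] (@compact_set1 _ t).
    by rewrite uniform_set1; apply => _ ->.
  apply: (cvgr_to_ge (cvg_calBrho_pointwise _ _ _ _ _ _ x _ Pt)).
  apply: nearW => n.
  by have [_ _ _ posP] := FP n; exact: posP.
Qed.

Theorem theorem3p2 (R : realType) :
  (forall (Z : completeNormedModType R) (P : nat -> R -> Z -> Z)
      (M omega : R) (D : set Z),
    1 <= M ->
    (forall n, C0_semigroup (P n)) ->
    (forall n, growth_bound M omega (P n)) ->
    D `<=` \bigcap_n generator_dom (P n) ->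
    dense (lspan D) ->
    generators_Cauchy_on D P ->
    exists Pinf : R -> Z -> Z,
      [/\ C0_semigroup Pinf,
          growth_bound M omega Pinf &
          cvg_unif_on_compact_times P Pinf])
  /\
  (forall (X : weightedSpace R) (P : nat -> R -> calBrho X -> calBrho X)
      (M omega : R) (D : set (calBrho X)),
    1 <= M ->
    (forall n, C0_semigroup (P n)) ->
    (forall n, growth_bound M omega (P n)) ->
    D `<=` \bigcap_n generator_dom (P n) ->
    dense (lspan D) ->
    generators_Cauchy_on D P ->
    (forall n, generalized_Feller (P n)) ->
    exists Pinf : R -> calBrho X -> calBrho X,
      [/\ C0_semigroup Pinf,
          growth_bound M omega Pinf,
          cvg_unif_on_compact_times P Pinf &
          generalized_Feller Pinf]).
Proof.
split=> [Z P M omega D M1 C0P gP _|X P M omega D M1 C0P gP _ dD genP FP].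
  exact: limit_semigroup_exists.
have [Pinf [C0Pinf gPinf P_Pinf]] :=
  @limit_semigroup_exists R (calBrho X) P M omega D M1 C0P gP dD genP.
exists Pinf; split=> //.
exact: generalized_Feller_limit M1 C0Pinf gPinf P_Pinf FP.
Qed.
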